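(* Let $m\ge1$ and $[m]=\{1<2<\dots<m\}$. For every poset ideal $\mathcal{J}\subseteq\mathrm{Hom}([m],\mathbb{N})$ the projected co-letterplace ideal $L^{p_2}([m],\mathcal{J})$ is a strongly stable $m$-regular ideal of $k[x_0,x_1,x_2,\dots]$, and $\mathcal{J}\mapsto L^{p_2}([m],\mathcal{J})$ is a one-to-one correspondence between poset ideals of $\mathrm{Hom}([m],\mathbb{N})$ and finitely generated strongly stable $m$-regular ideals of $k[x_0,x_1,x_2,\dots]$.
   Context: $\mathbb{N}=\{0,1,2,\dots\}$; $\mathrm{Hom}([m],\mathbb{N})$ is the set of weakly increasing maps $[m]\to\mathbb{N}$ ordered pointwise. A marker for $\mathcal{J}$ is a poset ideal $I=\{1,\dots,r\}\subseteq[m]$ ($0\le r\le m$) with an isotone $\alpha:I\to\mathbb{N}$ such that every isotone $\phi:[m]\to\mathbb{N}$ with $\phi|_I=\alpha$ lies in $\mathcal{J}$; its graph is $\Gamma\alpha=\{(a,\alpha(a)):a\in I\}$. $k$ is a field; the co-letterplace ideal $L([m],\mathcal{J})\subseteq k[x_{a,i}:(a,i)\in[m]\times\mathbb{N}]$ is generated by $\prod_{(a,i)\in\Gamma\alpha}x_{a,i}$ over all markers $\alpha$. $L^{p_2}([m],\mathcal{J})$ is the ideal of $k[x_0,x_1,\dots]$ generated by the images of these generators under $x_{a,i}\mapsto x_i$. A monomial ideal is strongly stable if for every monomial $u$ and $i<j$, $x_ju\in I$ implies $x_iu\in I$. A finitely generated ideal is $m$-regular if its Castelnuovo–Mumford regularity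 (in a polynomial subring in finitely many variables containing its generators) is at most $m$. *)

(* Defs.v *)
From Stdlib Require List.
From mathcomp Require Import all_boot all_order all_algebra.
From mathcomp Require Import mpoly.
Set Implicit Arguments. Unset Strict Implicit. Unset Printing Implicit Defensive.
Import GRing.Theory.
Local Open Scope ring_scope.

(* Hom([m], N): [m] = {1 < ... < m} is encoded as 'I_m (i : 'I_m stands   *)
(* for the element i+1); maps [m] -> N are finite functions.              *)
Definition isotone (m : nat) (phi : {ffun 'I_m -> nat}) : Prop :=
  forall i j : 'I_m, (i <= j)%N -> (phi i <= phi j)%N.

Definition hom_poset_ideal (m : nat) (J : {ffun 'I_m -> nat} -> Prop) : Prop :=
  (forall phi, J phi -> isotone phi) /\
  (forall phi psi, J phi -> isotone psi -> (forall i, (psi i <= phi i)%N) -> J psi).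

(* A marker for J: the ideal I = {1..r} (r <= m) of [m] and an isotone    *)
(* alpha : I -> N (encoded by a finite function on 'I_m of which only the *)
(* values at i < r matter) such that every isotone phi extending alpha    *)
(* lies in J.                                                              *)
Definition is_marker (m : nat) (J : {ffun 'I_m -> nat} -> Prop)
  (r : nat) (alpha : {ffun 'I_m -> nat}) : Prop :=
  (r <= m)%N /\
  (forall i j : 'I_m, (i <= j)%N -> (j < r)%N -> (alpha i <= alpha j)%N) /\
  (forall phi, isotone phi -> (forall i : 'I_m, (i < r)%N -> phi i = alpha i) -> J phi).

(* Monomials of k[x_0, x_1, x_2, ...] are encoded by their exponent       *)
(* functions nat -> nat of finite support.  A monomial ideal is encoded   *)
(* by the set (predicate) of monomials it contains.                        *)
Definition monomial (u : nat -> nat) : Prop :=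
  exists N, forall i, (N <= i)%N -> u i = 0%N.

Definition mdivides (u v : nat -> nat) : Prop := forall i, (u i <= v i)%N.

Definition mulx (i : nat) (u : nat -> nat) : nat -> nat :=
  fun t => (u t + (t == i))%N.

(* Image of prod_{(a,i) in Gamma alpha} x_{a,i} under x_{a,i} |-> x_i:     *)
(* the monomial prod_{a < r} x_{alpha a}.                                   *)
Definition marker_monomial (m : nat) (r : nat) (alpha : {ffun 'I_m -> nat})
  : nat -> nat :=
  fun t => #|[set a : 'I_m | (a < r)%N && (alpha a == t)]|.

Definition Lp2 (m : nat) (J : {ffun 'I_m -> nat} -> Prop) (u : nat -> nat)
  : Prop :=
  monomial u /\
  exists r alpha, is_marker J r alpha /\ mdivides (marker_monomial r alpha) u.

Definition strongly_stable (M : (nat -> nat) -> Prop) : Prop :=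
  forall u i j, monomial u -> (i < j)%N -> M (mulx j u) -> M (mulx i u).

Definition generates (M : (nat -> nat) -> Prop) (gs : seq (nat -> nat)) : Prop :=
  (forall g, List.In g gs -> monomial g) /\
  (forall u, M u <-> (monomial u /\ exists2 g, List.In g gs & mdivides g u)).

Definition fin_gen_monomial_ideal (M : (nat -> nat) -> Prop) : Prop :=
  exists gs, generates M gs.

Section Regularity.
Variable (k : fieldType) (n : nat).
Local Notation S := {mpoly k[n]}.

Definition homog_deg (d : nat) (p : S) : bool :=
  all (fun mm => mdeg mm == d) (msupp p).

Definition in_ideal_gen (a : nat) (G : 'rV[S]_a) (p : S) : Prop :=
  exists v : 'cV[S]_a, p = (G *m v) ord0 ord0.

(* G (a row of generators of an ideal I of S) admits a finite graded free  *)
(* resolution                                                              *)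
(*   0 -> F_p -> ... -> F_1 -> F_0 -> I -> 0,                              *)
(*   F_i = (+)_j S(-deg i j),  rank F_i = r i,                             *)
(* (g : F_0 -> I the generator row, phi i : F_(i+1) -> F_i acting on column *)
(* vectors by matrices with homogeneous entries of the right degrees) in   *)
(* which every shift satisfies deg i j - i <= reg.  An ideal has           *)
(* Castelnuovo-Mumford regularity <= reg iff such a resolution exists      *)
(* (the minimal one is a direct summand of any graded free resolution).    *)
Definition has_regular_resolution (a : nat) (G : 'rV[S]_a) (reg : nat) : Prop :=
  exists (r : nat -> nat) (deg : forall i, 'I_(r i) -> nat)
         (g : 'rV[S]_(r 0%N)) (phi : forall i, 'M[S]_(r i, r i.+1)),
    (exists p, forall i, (p < i)%N -> r i = 0%N) /\
    (forall q, in_ideal_gen G q <-> in_ideal_gen g q) /\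
    (forall j, homog_deg (deg 0%N j) (g ord0 j)) /\
    (forall i a b, homog_deg (deg i.+1 b - deg i a) (phi i a b) /\
                   (phi i a b != 0 -> (deg i a <= deg i.+1 b)%N)) /\
    (forall v : 'cV[S]_(r 0%N), g *m v = 0 <-> exists w, v = phi 0%N *m w) /\
    (forall i (v : 'cV[S]_(r i.+1)), phi i *m v = 0 <-> exists w, v = phi i.+1 *m w) /\
    (forall i j, (deg i j <= reg + i)%N).

End Regularity.

Definition mon_of (n : nat) (u : nat -> nat) : 'X_{1..n} :=
  [multinom u (nat_of_ord i) | i < n].

Definition gen_row (k : fieldType) (n : nat) (gs : seq (nat -> nat))
  : 'rV[{mpoly k[n]}]_(size gs) :=
  \row_(j < size gs) 'X_[mon_of n (nth (fun _ => 0%N) gs j)].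

(* A finitely generated monomial ideal M of k[x_0, x_1, ...] is            *)
(* reg-regular: its regularity, computed in a polynomial subring           *)
(* k[x_0..x_{n-1}] containing its generators, is at most reg.              *)
Definition regular_monomial_ideal (k : fieldType) (reg : nat)
  (M : (nat -> nat) -> Prop) : Prop :=
  exists (gs : seq (nat -> nat)) (n : nat),
    generates M gs /\
    (forall g, List.In g gs -> forall i, (n <= i)%N -> g i = 0%N) /\
    has_regular_resolution (gen_row k n gs) reg.

Definition fg_strongly_stable_regular (k : fieldType) (reg : nat)
  (M : (nat -> nat) -> Prop) : Prop :=
  fin_gen_monomial_ideal M /\ strongly_stable M /\ regular_monomial_ideal k reg M.

(* Main.v *)
Require Import Defs.
From mathcomp Require Import all_boot all_order all_algebra.
From mathcomp Require Import boolp mpoly zify.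
Set Implicit Arguments.
Unset Strict Implicit.
Unset Printing Implicit Defensive.
Import Order.TTheory GRing.Theory.

(* A monomial is a weakly increasing word.  Since J is down-closed, replacing
   the letters of a marker by smaller ones gives a marker again; hence a
   monomial lies in L^{p2}(J) iff some prefix of its sorted word is a marker.
   Strong stability follows, J is recovered as the set of words of length m
   in the ideal, and the minimal generators are the markers without a shorter
   marker prefix.  There are finitely many of them: after a prefix that is not
   a marker, only boundedly many next letters remain in J.

   For regularity, every monomial of the ideal is uniquely u w with u a minimal
   generator and w in the variables x_i, i >= max u.  Such a Pommaret basis
   h_j, with multiplicative variables x_i for i >= c_j, passes to syzygies: the
   relations s_(j,i) expressing x_i h_j (i < c_j) through the basis again form
   a Pommaret basis of the syzygy module, with classes i < c_j and degree one
   higher.  As the classes drop, iterating yields a finite resolution whose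
   shifts are at most m + i.  Conversely an m-regular monomial ideal is
   generated in degrees at most m, so it is L^{p2} of its words of length m. *)

Local Open Scope ring_scope.

(** * Supports of polynomials and of polynomial vectors *)

Section Supports.
Variables (R : comNzRingType) (n : nat).
Local Notation S := {mpoly R[n]}.
Local Notation mon := 'X_{1..n}.
Implicit Types (p q : S) (e : mon).

Definition supp_in (Q : mon -> Prop) (p : S) : Prop :=
  forall e, e \in msupp p -> Q e.

Lemma supp_in0 Q : supp_in Q 0.
Proof. by move=> e; rewrite msupp0. Qed.

Lemma supp_inD Q p q : supp_in Q p -> supp_in Q q -> supp_in Q (p + q).
Proof. by move=> hp hq e /msuppD_le; rewrite mem_cat => /orP[/hp|/hq]. Qed.

Lemma supp_inN Q p : supp_in Q p -> supp_in Q (- p).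
Proof. by move=> hp e; rewrite (perm_mem (msuppN p)) => /hp. Qed.

Lemma supp_inX (Q : mon -> Prop) e : Q e -> supp_in Q 'X_[e].
Proof. by move=> Qe e' /mem_msuppXP <-. Qed.

Lemma supp_inZ Q (x : R) p : supp_in Q p -> supp_in Q (x *: p).
Proof. by move=> hp e /msuppZ_le /hp. Qed.

Lemma supp_inS (Q Q' : mon -> Prop) p :
  (forall e, Q e -> Q' e) -> supp_in Q p -> supp_in Q' p.
Proof. by move=> QQ' hp e /hp /QQ'. Qed.

Lemma supp_inXM (Q Q' : mon -> Prop) e p :
  (forall e', Q e' -> Q' (e + e')%MM) -> supp_in Q p -> supp_in Q' ('X_[e] * p).
Proof.
move=> QQ' hp e0 /msuppM_le /allpairsP[[e1 e2] /= [/mem_msuppXP <- /hp + ->]].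
exact: QQ'.
Qed.

Lemma supp_in_False p : supp_in (fun=> False) p -> p = 0.
Proof.
move=> hp; apply: msuppnil0.
by case: (msupp p) (hp : {in msupp p, _}) => // e s /(_ e (mem_head _ _)).
Qed.

Lemma mcoeffMX_eq0 p e e' :
  (forall e1, e1 \in msupp p -> (e1 + e)%MM <> e') -> (p * 'X_[e])@_e' = 0.
Proof.
move=> ne; apply: contraTeq (eqxx e') => nz.
have : e' \in msupp (p * 'X_[e]) by rewrite mcoeff_msupp.
by move=> /msuppM_le /allpairsP[[e1 e2] /= [/ne e1e /mem_msuppXP <- /esym]].
Qed.

Lemma sum_mulX_eq0 (I : finType) (A : pred I) (V : I -> mon -> Prop)
    (u : I -> mon) (f : I -> S) :
  (forall i, A i -> supp_in (V i) (f i)) ->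
  (forall i j e e', A i -> A j -> V i e -> V j e' ->
     (u i + e = u j + e')%MM -> i = j) ->
  \sum_(i | A i) f i * 'X_[u i] = 0 -> forall i, A i -> f i = 0.
Proof.
move=> hf no_collision sum0 i Ai; apply/mpolyP => e; rewrite mcoeff0.
have [he|] := boolP (e \in msupp (f i)); last first.
  by rewrite -mcoeff_eq0 => /eqP.
have /(congr1 (mcoeff (u i + e)%MM)) := sum0.
rewrite mcoeff0 raddf_sum (bigD1 i) //= mcoeffMX big1 ?addr0 // => j.
move=> /andP[Aj ji]; apply: mcoeffMX_eq0 => e' he' eE; case/eqP: ji; apply/esym.
apply: no_collision Ai Aj (hf i Ai e he) (hf j Aj e' he') _.
by rewrite -eE addmC.
Qed.

Definition vsupp_in (b : nat) (Q : 'I_b -> mon -> Prop) (v : 'cV[S]_b) : Prop :=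
  forall l, supp_in (Q l) (v l ord0).

Section Vectors.
Variable b : nat.
Implicit Types (v w : 'cV[S]_b) (Q : 'I_b -> mon -> Prop).

Lemma vsupp_in0 Q : vsupp_in Q 0.
Proof. by move=> l; rewrite mxE; apply: supp_in0. Qed.

Lemma vsupp_inD Q v w : vsupp_in Q v -> vsupp_in Q w -> vsupp_in Q (v + w).
Proof. by move=> hv hw l; rewrite mxE; apply: supp_inD. Qed.

Lemma vsupp_inB Q v w : vsupp_in Q v -> vsupp_in Q w -> vsupp_in Q (v - w).
Proof.
by move=> hv hw l; rewrite !mxE; apply: supp_inD (hv l) (supp_inN (hw l)).
Qed.

Lemma vsupp_inZ Q (x : R) v : vsupp_in Q v -> vsupp_in Q (x%:MP *: v).
Proof. by move=> hv l; rewrite mxE mul_mpolyC; apply: supp_inZ. Qed.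

Lemma vsupp_inS Q Q' v :
  (forall l e, Q l e -> Q' l e) -> vsupp_in Q v -> vsupp_in Q' v.
Proof. by move=> QQ' hv l; apply: supp_inS (hv l) => e; apply: QQ'. Qed.

Lemma vsupp_inXM Q Q' e v :
  (forall l e', Q l e' -> Q' l (e + e')%MM) ->
  vsupp_in Q v -> vsupp_in Q' ('X_[e] *: v).
Proof.
by move=> QQ' hv l; rewrite mxE; apply: supp_inXM (hv l) => e'; apply: QQ'.
Qed.

Lemma vsupp_in_delta Q l e : Q l e -> vsupp_in Q ('X_[e] *: delta_mx l ord0).
Proof.
move=> Qle l'; rewrite !mxE eqxx andbT; case: eqP => [->|_].
  by rewrite mulr1; apply: supp_inX.
by rewrite mulr0; apply: supp_in0.
Qed.

Lemma vec_mpolyE v :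
  v = \sum_l \sum_(e <- msupp (v l ord0))
        ((v l ord0)@_e)%:MP *: ('X_[e] *: delta_mx l ord0).
Proof.
rewrite [LHS]matrix_sum_delta; apply: eq_bigr => l _.
rewrite big_ord1 {1}[v l ord0]mpolyE scaler_suml; apply: eq_bigr => e _.
by rewrite scalerA mul_mpolyC.
Qed.

End Vectors.

Definition vars_ge (c : nat) (e : mon) : Prop :=
  forall i : 'I_n, (i < c)%N -> e i = 0%N.

Lemma vars_ge_or_factor c e :
  vars_ge c e \/
  exists (i : 'I_n) e', [/\ (i < c)%N, vars_ge i e' & e = (U_(i) + e')%MM].
Proof.
pose small (i : 'I_n) := (i < c)%N && (e i != 0%N).
case: (pickP small) => [i0 small_i0|none]; last first.
  by left=> i ic; apply/eqP; have := none i; rewrite /small ic => /negbFE.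
right; case: (arg_minnP val small_i0) => i /andP[ic ei] i_min.
exists i, (e - U_(i))%MM; split=> // [j ji|].
  suff /eqP ej : e j == 0%N by rewrite mnmBE ej sub0n.
  apply: contraT => ej.
  by have := i_min j; rewrite /small ej (ltn_trans ji ic) leqNgt ji => /(_ isT).
rewrite addmC submK //; apply/mnm_lepP => j.
by rewrite mnm1E; case: eqP => // <-; rewrite lt0n.
Qed.

Lemma least_var_uniq (i j : 'I_n) e e' : vars_ge i e -> vars_ge j e' ->
  (U_(i) + e = U_(j) + e')%MM -> i = j.
Proof.
wlog ij : i j e e' / (i <= j)%N => [wlog_ij ie je' eE|ie je' /mnmP/(_ i)].
  have [ij|/ltnW ji] := leqP i j; first exact: wlog_ij ij ie je' eE.
  by apply/esym/(wlog_ij _ _ _ _ ji je' ie)/esym.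
move: ij; rewrite leq_eqVlt => /orP[/eqP/val_inj //|ij].
by rewrite !mnmDE !mnm1E eqxx (je' i ij) -val_eqE gtn_eqF.
Qed.

End Supports.

(** * Pommaret bases and their syzygies *)

Section Pommaret.
Variables (R : comNzRingType) (n : nat).
Local Notation S := {mpoly R[n]}.
Local Notation mon := 'X_{1..n}.

Definition exact_at (a b b' : nat) (A : 'M[S]_(a, b))
    (B : 'M[S]_(b, b')) : Prop :=
  forall v : 'cV[S]_b, A *m v = 0 <-> exists w, v = B *m w.

Definition graded_mx (b b' : nat) (d : 'I_b -> nat) (d' : 'I_b' -> nat)
    (A : 'M[S]_(b, b')) : Prop :=
  forall x y, supp_in (fun e => mdeg e + d x = d' y)%N (A x y).

Definition nonmult (b : nat) (c : 'I_b -> nat) : {pred 'I_b * 'I_n} :=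
  [pred y : 'I_b * 'I_n | (y.2 < c y.1)%N].

Definition mult_free (a b : nat) (H : 'M[S]_(a, b)) (c : 'I_b -> nat) : Prop :=
  forall v : 'cV[S]_b,
    vsupp_in (fun l => vars_ge (c l)) v -> H *m v = 0 -> v = 0.

Definition reduced (b : nat) (c rho d : 'I_b -> nat) (j : 'I_b)
    (v : 'cV[S]_b) : Prop :=
  vsupp_in (fun l e => [/\ vars_ge (c l) e, (rho l < rho j)%N &
                           (mdeg e + d l)%N = (d j).+1]) v.

(* The columns h_j of [H], of degree [d j], are a Pommaret basis of their span
   with multiplicative variables x_i, i >= [c j]: multiplicative combinations
   are unique, and every product x_i h_j, i < [c j], is one.  The rank [rho]
   decreases along these rewritings, so that they terminate. *)
Definition pommaret_basis (a b : nat) (H : 'M[S]_(a, b))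
    (c rho d : 'I_b -> nat) : Prop :=
  mult_free H c /\
  (forall y, y \in nonmult c -> exists2 v : 'cV[S]_b,
     H *m ('X_y.2 *: delta_mx y.1 ord0) = H *m v & reduced c rho d y.1 v).

Section Syzygies.
Variables (a b : nat) (H : 'M[S]_(a, b)) (c rho d : 'I_b -> nat).
Hypothesis H_free : mult_free H c.
Variable nf : 'I_b * 'I_n -> 'cV[S]_b.
Hypothesis nfE : forall y, y \in nonmult c ->
  H *m ('X_y.2 *: delta_mx y.1 ord0) = H *m nf y.
Hypothesis nf_reduced : forall y, y \in nonmult c -> reduced c rho d y.1 (nf y).

Definition syz (y : 'I_b * 'I_n) : 'cV[S]_b :=
  'X_y.2 *: delta_mx y.1 ord0 - nf y.

Local Notation idx := (@enum_val _ (nonmult c)).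
Local Notation rank x := (rho (idx x).1).

Definition syzmx : 'M[S]_(b, #|nonmult c|) := \matrix_(l, x) syz (idx x) l ord0.

Lemma mul_syz y : y \in nonmult c -> H *m syz y = 0.
Proof. by move=> yc; rewrite mulmxBr nfE // subrr. Qed.

Lemma syzE y l : syz y l ord0 = 'X_y.2 * (l == y.1)%:R - nf y l ord0.
Proof. by rewrite !mxE eqxx andbT. Qed.

Lemma syzmx_delta x : syzmx *m delta_mx x ord0 = syz (idx x).
Proof. by rewrite -colE; apply/colP => l; rewrite !mxE. Qed.

Lemma mul_syzmx : H *m syzmx = 0.
Proof.
apply/matrixP => r x; have /matrixP/(_ r ord0) := mul_syz (enum_valP x).
by rewrite -syzmx_delta mulmxA -colE !mxE.
Qed.

Definition rank_closed (Q : 'I_b -> mon -> Prop) : Prop :=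
  forall l e l' e', Q l e -> (rho l' <= rho l)%N ->
    (mdeg e' + d l')%N = (mdeg e + d l)%N -> Q l' e'.

Section Reduction.
Variable Q : 'I_b -> mon -> Prop.
Hypothesis Q_closed : rank_closed Q.

Definition reducible (v : 'cV[S]_b) : Prop :=
  exists v' q, [/\ v = v' + syzmx *m q,
    vsupp_in (fun l e => vars_ge (c l) e /\ Q l e) v' &
    vsupp_in (fun x e => vars_ge (idx x).2 e /\
                Q (idx x).1 (U_((idx x).2) + e)%MM) q].

Lemma reducible0 : reducible 0.
Proof. by exists 0, 0; rewrite mulmx0 addr0; split=> //; apply: vsupp_in0. Qed.

Lemma reducibleD v w : reducible v -> reducible w -> reducible (v + w).
Proof.
move=> [v1 [q1 [-> hv1 hq1]]] [v2 [q2 [-> hv2 hq2]]].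
exists (v1 + v2), (q1 + q2); rewrite mulmxDr addrACA.
by split=> //; apply: vsupp_inD.
Qed.

Lemma reducibleZ (x : R) v : reducible v -> reducible (x%:MP *: v).
Proof.
move=> [v' [q [-> hv' hq]]]; exists (x%:MP *: v'), (x%:MP *: q).
by rewrite scalerDr scalemxAr; split=> //; apply: vsupp_inZ.
Qed.

Lemma reducible_terms (v : 'cV[S]_b) :
  (forall l e, e \in msupp (v l ord0) ->
     reducible ('X_[e] *: delta_mx l ord0)) -> reducible v.
Proof.
move=> hv; rewrite [v]vec_mpolyE.
apply: (big_ind _ reducible0 reducibleD) => l _; rewrite big_seq.
by apply: (big_ind _ reducible0 reducibleD) => e he; apply/reducibleZ/hv.
Qed.

Lemma reducible_multiplicative l e : vars_ge (c l) e -> Q l e ->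
  reducible ('X_[e] *: delta_mx l ord0).
Proof.
move=> ec Qle; exists ('X_[e] *: delta_mx l ord0), 0; rewrite mulmx0 addr0.
by split=> //; [apply: vsupp_in_delta | apply: vsupp_in0].
Qed.

Lemma reducible_syz y e : y \in nonmult c -> vars_ge y.2 e ->
  Q y.1 (U_(y.2) + e)%MM -> reducible ('X_[e] *: syz y).
Proof.
move=> yc ey Qye; pose x := enum_rank_in yc y.
have xy : idx x = y by apply: enum_rankK_in.
exists 0, ('X_[e] *: delta_mx x ord0); rewrite add0r -scalemxAr syzmx_delta xy.
by split=> //; [apply: vsupp_in0 | apply: vsupp_in_delta; rewrite xy].
Qed.

Lemma reducible_term l e : Q l e -> reducible ('X_[e] *: delta_mx l ord0).
Proof.
have [r] := ubnP (rho l); elim: r l e => // r IHr l e /ltnSE rho_l Qle.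
have [ec|[i [e' [ic e'i eE]]]] := vars_ge_or_factor (c l) e.
  exact: reducible_multiplicative.
have yc : (l, i) \in nonmult c by [].
have -> : 'X_[e] *: delta_mx l ord0 =
    'X_[e'] *: syz (l, i) + 'X_[e'] *: nf (l, i).
  by rewrite -scalerDr subrK scalerA -mpolyXD addmC -eE.
apply: reducibleD; first by apply: reducible_syz; rewrite -?eE.
apply: reducible_terms => l' e'' he''.
pose below l0 (e0 : mon) :=
  (rho l0 < rho l)%N /\ (mdeg e0 + d l0 = mdeg e + d l)%N.
have [rho_l' deg_e''] : below l' e''.
  suff : vsupp_in below ('X_[e'] *: nf (l, i)) by move/(_ _ _ he'').
  apply: vsupp_inXM (nf_reduced yc) => l0 e0 [_ rho_l0 deg_e0]; split=> //.
  by rewrite eE !mdegD mdeg1 /= in deg_e0 *; lia.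
apply: IHr; first exact: leq_trans rho_l' rho_l.
by apply: Q_closed Qle _ deg_e''; apply: ltnW.
Qed.

Lemma vsupp_in_reducible (v : 'cV[S]_b) : vsupp_in Q v -> reducible v.
Proof.
by move=> hv; apply: reducible_terms => l e /hv; apply: reducible_term.
Qed.

Lemma vsupp_in_ker (v : 'cV[S]_b) : vsupp_in Q v -> H *m v = 0 ->
  exists2 q, v = syzmx *m q &
    vsupp_in (fun x e => vars_ge (idx x).2 e /\
                Q (idx x).1 (U_((idx x).2) + e)%MM) q.
Proof.
move=> /vsupp_in_reducible[v' [q [vE hv' hq]]] Hv; exists q => //.
rewrite vE (H_free (v := v')) ?add0r //.
  by apply: vsupp_inS hv' => l e [].
by move: Hv; rewrite vE mulmxDr mulmxA mul_syzmx mul0mx addr0.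
Qed.

End Reduction.

Lemma exact_at_syzmx : exact_at H syzmx.
Proof.
move=> v; split=> [|[w ->]]; last by rewrite mulmxA mul_syzmx mul0mx.
by move=> /(vsupp_in_ker (Q := fun _ _ => True))[] // q -> _; exists q.
Qed.

Lemma graded_syzmx : graded_mx d (fun x => (d (idx x).1).+1) syzmx.
Proof.
move=> l x; rewrite mxE; move: l.
suff : vsupp_in (fun l e => mdeg e + d l = (d (idx x).1).+1)%N (syz (idx x)).
  by [].
apply: vsupp_inB; first by apply: vsupp_in_delta; rewrite mdeg1 add1n.
by apply: vsupp_inS (nf_reduced (enum_valP x)) => l e [].
Qed.

Lemma reduced_coef_eq0 y l : y \in nonmult c -> (rho y.1 <= rho l)%N ->
  nf y l ord0 = 0.
Proof.
move=> /nf_reduced/(_ l) hnf rho_l; apply: supp_in_False.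
by apply: supp_inS hnf => e [_]; rewrite ltnNge rho_l.
Qed.

Lemma syzmx_top_coef (q : 'cV[S]_#|nonmult c|) l :
  (forall x, (rho l < rank x)%N -> q x ord0 = 0) ->
  (syzmx *m q) l ord0 = \sum_(x | (idx x).1 == l) q x ord0 * 'X_(idx x).2.
Proof.
move=> q0; rewrite mxE (bigID (fun x => (idx x).1 == l)) /=.
rewrite [X in _ + X]big1 => [|x].
  rewrite addr0; apply: eq_bigr => x /eqP xl.
  by rewrite mxE syzE reduced_coef_eq0 ?enum_valP ?xl // eqxx subr0 mulr1 mulrC.
have [/q0 -> _|rho_x xl] := ltnP (rho l) (rank x); first by rewrite mulr0.
rewrite mxE syzE reduced_coef_eq0 ?enum_valP // eq_sym (negPf xl).
by rewrite mulr0 subr0 mul0r.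
Qed.

Lemma mult_free_syzmx : mult_free syzmx (fun x => (idx x).2).
Proof.
move=> q hq sq0; apply/colP => x0; rewrite mxE; apply/eqP/negPn/negP => qx0.
case: (@arg_maxnP _ x0 (fun x => q x ord0 != 0) (fun x => rank x) qx0).
move=> x /eqP qx x_max; apply: qx.
have q0 z : (rank x < rank z)%N -> q z ord0 = 0.
  move=> xz; apply/eqP/negPn/negP => /x_max.
  by rewrite /geq /= leqNgt xz.
apply: (sum_mulX_eq0 (A := [pred z | (idx z).1 == (idx x).1])
  (V := fun z => vars_ge (idx z).2) (u := fun z => U_((idx z).2)%MM)
  (f := fun z => q z ord0)) => //=.
  move=> y z e e' /eqP yx /eqP zx ey ez /(least_var_uniq ey ez) yz.
  apply: enum_val_inj.
  by rewrite [idx y]surjective_pairing [idx z]surjective_pairing yx zx yz.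
by rewrite -syzmx_top_coef // sq0 mxE.
Qed.

(* For t < i < c_j, the relation x_t s_(j,i) - x_i s_(j,t) is again a syzygy of
   the columns, supported in smaller rank. *)
Lemma syzmx_prolongation (j : 'I_b) (i t : 'I_n) : (i < c j)%N -> (t < i)%N ->
  exists2 q : 'cV[S]_#|nonmult c|,
    'X_t *: syz (j, i) = 'X_i *: syz (j, t) + syzmx *m q &
    vsupp_in (fun x e => [/\ vars_ge (idx x).2 e, (rank x < rho j)%N &
                             (mdeg e + (d (idx x).1).+1)%N = (d j).+2]) q.
Proof.
move=> ic ti; have tc : (t < c j)%N by apply: ltn_trans ti ic.
pose v : 'cV[S]_b := 'X_i *: nf (j, t) - 'X_t *: nf (j, i).
have vE : 'X_t *: syz (j, i) = 'X_i *: syz (j, t) + v.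
  rewrite /v !scalerBr !scalerA /= ['X_t * 'X_i]mulrC.
  by rewrite -[in RHS]addrA [_ + (_ - _)]addrA addNr add0r.
pose Q l (e : mon) := (rho l < rho j)%N /\ (mdeg e + d l)%N = (d j).+2.
have Q_closed : rank_closed Q.
  move=> l e l' e' [lj eD] l'l e'D.
  by split; [apply: leq_ltn_trans l'l lj | rewrite e'D].
have hXnf (s s' : 'I_n) : (s < c j)%N -> vsupp_in Q ('X_s' *: nf (j, s)).
  move=> sc; apply: vsupp_inXM (nf_reduced (y := (j, s)) sc) => l e [_ lj eD].
  by split; rewrite // mdegD mdeg1 /= in eD *; lia.
have Hv : H *m v = 0.
  have /(congr1 (mulmx H)) := vE.
  rewrite mulmxDr -!scalemxAr (mul_syz (y := (j, i))) //.
  by rewrite (mul_syz (y := (j, t))) // !scaler0 add0r.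
have hv : vsupp_in Q v by apply: vsupp_inB; apply: hXnf.
have [q vq hq] := vsupp_in_ker Q_closed hv Hv; exists q; first by rewrite vE vq.
apply: vsupp_inS hq => x e [ex [xj eD]]; split=> //.
by rewrite mdegD mdeg1 in eD; lia.
Qed.

(* The rank of s_(j,i) is the pair (rho_j, i), ordered lexicographically. *)
Lemma pommaret_basis_syzmx :
  pommaret_basis syzmx (fun x => (idx x).2 : nat)
    (fun x => (rank x * n.+1 + (idx x).2)%N) (fun x => (d (idx x).1).+1).
Proof.
split=> [|[x t]]; first exact: mult_free_syzmx.
rewrite inE /= => ti; have := enum_valP x.
case xE: (idx x) ti => [j i] /= ti ic.
have tc : (j, t) \in nonmult c by apply: ltn_trans ti ic.
pose x' := enum_rank_in tc (j, t).
have x'E : idx x' = (j, t) by apply: enum_rankK_in.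
have [q eq hq] := syzmx_prolongation ic ti.
exists ('X_i *: delta_mx x' ord0 + q).
  by rewrite mulmxDr -!scalemxAr !syzmx_delta xE x'E.
apply: vsupp_inD.
  apply: vsupp_in_delta; rewrite x'E xE mdeg1 ltn_add2l; split=> // s st.
  by rewrite mnm1E; case: eqP ti => // ->; rewrite ltnNge ltnW.
apply: vsupp_inS hq => y e [ey yj eD]; rewrite xE; split=> //=.
apply/ltn_addr/(leq_trans _ (leq_mul yj (leqnn n.+1))).
by rewrite mulSn addnC ltn_add2r ltnS ltnW.
Qed.

End Syzygies.

(** * Regular resolutions *)

Record resolution_data := ResolutionData {
  res_rank : nat -> nat;
  res_deg : forall i, 'I_(res_rank i) -> nat;
  res_diff : forall i, 'M[S]_(res_rank i, res_rank i.+1)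
}.

Definition regular_resolution (a : nat) (C : resolution_data)
    (H : 'M[S]_(a, res_rank C 0)) (reg : nat) : Prop :=
  [/\ exists p, forall i, (p < i)%N -> res_rank C i = 0%N,
      forall i, graded_mx (@res_deg C i) (@res_deg C i.+1) (res_diff C i),
      exact_at H (res_diff C 0),
      forall i, exact_at (res_diff C i) (res_diff C i.+1) &
      forall i j, (@res_deg C i j <= reg + i)%N].

Definition res0 : resolution_data :=
  @ResolutionData (fun=> 0%N) (fun _ _ => 0%N) (fun=> 0).

Definition res_cons (b : nat) (d : 'I_b -> nat) (C : resolution_data)
    (psi : 'M[S]_(b, res_rank C 0)) : resolution_data :=
  @ResolutionData (fun i => if i is i'.+1 then res_rank C i' else b)
    (fun i => match i
       return 'I_(if i is i'.+1 then res_rank C i' else b) -> nat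
       with 0 => d | i'.+1 => @res_deg C i' end)
    (fun i => match i
       return 'M[S]_(if i is i'.+1 then res_rank C i' else b, res_rank C i)
       with 0 => psi | i'.+1 => res_diff C i' end).

Lemma regular_resolution0 (a reg : nat) (H : 'M[S]_(a, 0)) :
  regular_resolution (C := res0) H reg.
Proof.
have exact0 a' (A : 'M[S]_(a', 0)) : exact_at A (0 : 'M[S]_0).
  move=> v; rewrite [v]flatmx0 mulmx0; split=> // _.
  by exists 0; rewrite mulmx0.
by split=> [|i []|||i []] //; exists 0%N.
Qed.

Lemma regular_resolution_cons (a b : nat) (H : 'M[S]_(a, b)) d C
    (psi : 'M[S]_(b, res_rank C 0)) (reg : nat) :
  exact_at H psi -> graded_mx d (@res_deg C 0) psi ->
  (forall j, d j <= reg)%N -> regular_resolution psi reg.+1 ->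
  regular_resolution (C := res_cons d psi) H reg.
Proof.
move=> Hpsi psi_graded dreg [[p hp] graded psi_diff diff_diff degreg].
split=> //.
- by exists p.+1 => -[|i] //; apply: hp.
- by case.
- by case.
- case=> [|i] j /=; first by rewrite addn0.
  by rewrite addnS -addSn.
Qed.

(* Induction on the largest class: the classes of the syzygies strictly drop. *)
Lemma pommaret_regular_resolution (a b : nat) (H : 'M[S]_(a, b)) c rho d reg :
  pommaret_basis H c rho d -> (forall j, d j <= reg)%N ->
  exists C psi, regular_resolution (C := @res_cons b d C psi) H reg.
Proof.
have [N] : exists N, forall j, (c j <= N)%N.
  by exists (\max_j c j) => j; apply: leq_bigmax.
elim: N a b H c rho d reg => [|N IHN] a b H c rho d reg cN [H_free red] dreg.
  exists res0, 0; apply: regular_resolution_cons => // [v|x [] //|]; last first.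
    exact: regular_resolution0.
  split=> [Hv|[w ->]]; last by rewrite mul0mx mulmx0.
  exists 0; rewrite mulmx0; apply: H_free Hv => l e _ i il.
  by have := leq_trans il (cN l).
have /fin_all_exists2[nf nfE nf_reduced] : forall y, exists2 v : 'cV[S]_b,
    y \in nonmult c -> H *m ('X_y.2 *: delta_mx y.1 ord0) = H *m v &
    y \in nonmult c -> reduced c rho d y.1 v.
  move=> y; have [/red[v]|_] := boolP (y \in nonmult c); first by exists v.
  by exists 0.
have syz_basis := pommaret_basis_syzmx H_free nfE nf_reduced.
have [x|x|C [psi C_res]] := IHN _ _ _ _ _ _ reg.+1 _ syz_basis.
- by rewrite -ltnS; apply: leq_trans (enum_valP x) (cN _).
- by rewrite ltnS.
pose C' := res_cons (fun x : 'I_#|nonmult c| => (d (enum_val x).1).+1) psi.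
exists C', (syzmx c nf); apply: (regular_resolution_cons (C := C')) => //.
  exact: (exact_at_syzmx H_free nfE nf_reduced).
exact: (graded_syzmx nf_reduced).
Qed.

End Pommaret.

Section MonomialRows.
Variables (R : comNzRingType) (n b : nat).
Local Notation mon := 'X_{1..n}.
Variable u : 'I_b -> mon.

Definition monomial_row : 'rV[{mpoly R[n]}]_b := \row_j 'X_[u j].

Lemma mul_monomial_row (v : 'cV[{mpoly R[n]}]_b) :
  monomial_row *m v = (\sum_j v j ord0 * 'X_[u j])%:M.
Proof.
apply/matrixP => i j; rewrite !ord1 !mxE eqxx mulr1n.
by apply: eq_bigr => l _; rewrite mxE mulrC.
Qed.

Lemma mul_monomial_row_delta (p : {mpoly R[n]}) j :
  monomial_row *m (p *: delta_mx j ord0 : 'cV_b) = (p * 'X_[u j])%:M.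
Proof.
by rewrite -scalemxAr -colE; apply/matrixP => i i'; rewrite !ord1 !mxE eqxx.
Qed.

Lemma pommaret_basis_monomial_row (c rho : 'I_b -> nat) :
  (forall j j' e e', vars_ge (c j) e -> vars_ge (c j') e' ->
     (u j + e = u j' + e')%MM -> j = j') ->
  (forall j (i : 'I_n), (i < c j)%N -> exists j' e,
     [/\ vars_ge (c j') e, (rho j' < rho j)%N & (U_(i) + u j = u j' + e)%MM]) ->
  pommaret_basis monomial_row c rho (mdeg \o u).
Proof.
move=> decomp_uniq decomp; split=> [v hv|[j i] /decomp[j' [e [ec rho_j' eE]]]].
  rewrite mul_monomial_row => /matrixP/(_ ord0 ord0).
  rewrite !mxE eqxx mulr1n => sum0; apply/colP => j; rewrite mxE.
  apply: sum_mulX_eq0 sum0 j _ => // [j _|j j' e e' _ _]; first exact: hv.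
  exact: decomp_uniq.
exists ('X_[e] *: delta_mx j' ord0) => /=.
  by rewrite !mul_monomial_row_delta -!mpolyXD eE addmC.
apply: vsupp_in_delta; split=> //=; have /(congr1 mdeg) := eE.
by rewrite !mdegD mdeg1 add1n => ->; apply: addnC.
Qed.

End MonomialRows.

Section Regularity.
Variables (k : fieldType) (n : nat).

Lemma supp_in_homog_deg (D d : nat) (p : {mpoly k[n]}) :
  supp_in (fun e => mdeg e + d = D)%N p ->
  homog_deg (D - d) p /\ (p != 0 -> (d <= D)%N).
Proof.
move=> hp; split; first by apply/allP => e /hp <-; rewrite addnK.
rewrite -msupp_eq0; case: (msupp p) (hp : {in msupp p, _}) => // e s.
by move=> /(_ e (mem_head _ _)) <- _; apply: leq_addl.
Qed.

Lemma regular_resolution_has_regular_resolution (C : resolution_data k n)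
    (g : 'rV_(res_rank C 0)) (reg : nat) :
  regular_resolution g reg -> (forall j, homog_deg (res_deg j) (g ord0 j)) ->
  has_regular_resolution g reg.
Proof.
move=> [finite graded g_diff diff_diff degreg] g_homog.
exists (res_rank C), (@res_deg _ _ C), g, (res_diff C).
split=> //; split=> //; split=> //.
by split=> [i x y|//]; apply: supp_in_homog_deg; apply: graded.
Qed.

Lemma pommaret_monomial_row_regular (b reg : nat) (u : 'I_b -> 'X_{1..n})
    c rho :
  pommaret_basis (monomial_row k u) c rho (mdeg \o u) ->
  (forall j, mdeg (u j) <= reg)%N ->
  has_regular_resolution (monomial_row k u) reg.
Proof.
move=> basis /(pommaret_regular_resolution basis)[C [psi res]].
apply: (regular_resolution_has_regular_resolution res) => j.
by rewrite mxE /homog_deg msuppX /= eqxx.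
Qed.

Lemma in_ideal_gen_entry b (G : 'rV[{mpoly k[n]}]_b) j :
  in_ideal_gen G (G ord0 j).
Proof. by exists (delta_mx j ord0); rewrite -colE mxE. Qed.

Lemma msupp_in_ideal_gen b (G : 'rV[{mpoly k[n]}]_b) p e :
  in_ideal_gen G p -> e \in msupp p ->
  exists j, exists2 e', e' \in msupp (G ord0 j) & (e' <= e)%MM.
Proof.
move=> [v ->]; rewrite mxE => /msupp_sum_le /flattenP[t /mapP[j _ ->]].
move=> /msuppM_le /allpairsP[[e' e''] /= [he' _ ->]].
by exists j, e' => //; apply: lem_addr.
Qed.

(* Multiplying out, each [u j] is divisible by a monomial of one of the
   homogeneous generators of the resolution. *)
Lemma regular_monomial_row_low_degree (b reg : nat) (u : 'I_b -> 'X_{1..n}) j :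
  has_regular_resolution (monomial_row k u) reg ->
  exists j' e, [/\ (u j' <= e)%MM, (e <= u j)%MM & (mdeg e <= reg)%N].
Proof.
move=> [r [deg [g [_ [_ [same_ideal [g_homog [_ [_ [_ degreg]]]]]]]]]].
have /same_ideal uj_g := in_ideal_gen_entry (monomial_row k u) j.
have [|i [e he euj]] := msupp_in_ideal_gen (e := u j) uj_g.
  by rewrite mxE msuppX mem_head.
have /same_ideal gi_u := in_ideal_gen_entry g i.
have [j' [e' + e'e]] := msupp_in_ideal_gen gi_u he.
rewrite mxE => /mem_msuppXP uj'E; exists j', e; split; rewrite ?uj'E //.
have /allP/(_ _ he)/eqP -> := g_homog i.
by have := degreg 0%N i; rewrite addn0.
Qed.

End Regularity.

(** * Sorted words *)

Local Open Scope nat_scope.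

Lemma In_mem (T : eqType) (x : T) s : List.In x s <-> x \in s.
Proof.
elim: s => //= y s IHs; rewrite inE eq_sym; split=> [[->|/IHs ->]|].
- by rewrite eqxx.
- by rewrite orbT.
- by move=> /orP[/eqP|/IHs]; [left | right].
Qed.

Lemma sorted_nth_leq s i v : sorted leq s -> i < size s ->
  (nth 0 s i <= v) = (i < count (leq^~ v) s).
Proof.
move=> ss i_s; apply/idP/idP; last exact: (nth_count_le 0).
apply: contraTT; rewrite -leqNgt -ltnNge => i_count.
by apply: (nth_count_gt 0) => //; rewrite i_count.
Qed.

Lemma sorted_cat_last s w :
  sorted leq (s ++ w) =
  [&& sorted leq s, sorted leq w & all (leq (last 0 s)) w].
Proof.
case: s => [|x s] /=.
  by rewrite (eq_all (a2 := predT)) // all_predT andbT.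
by rewrite cat_path (path_sortedE leq_trans (last x s)) [all _ _ && _]andbC.
Qed.

Lemma sorted_nseq k x : sorted leq (nseq k x).
Proof. by case: k => //= k; elim: k => //= k ->; rewrite leqnn. Qed.

Lemma sorted_cat_nseq s k x :
  sorted leq s -> last 0 s <= x -> sorted leq (s ++ nseq k x).
Proof.
by move=> ss sx; rewrite sorted_cat_last ss sorted_nseq all_nseq sx orbT.
Qed.

Lemma sorted_leq_last s x : sorted leq s -> x \in s -> x <= last 0 s.
Proof.
move=> ss /splitPr xs; case: xs ss => a b; rewrite last_cat /= => sab.
have := subseq_sorted leq_trans (suffix_subseq a (x :: b)) sab.
rewrite /= path_sortedE; last exact: leq_trans.
move=> /andP[xb _]; have := mem_last x b.
by rewrite inE => /orP[/eqP -> | /(allP xb)].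
Qed.

Lemma all2_leqP s t :
  reflect (size s = size t /\ forall i, i < size s -> nth 0 s i <= nth 0 t i)
          (all2 leq s t).
Proof.
elim: s t => [|x s IHs] [|y t] /=; try by constructor=> // -[].
apply: (iffP andP) => [[xy /IHs[st le_st]]|[[st] le_st]].
  by split=> [|[|i]]; [rewrite st | | apply: le_st].
by split; [apply: (le_st 0) | apply/IHs; split=> // i; apply: (le_st i.+1)].
Qed.

Lemma all2_leq_cat s s' t t' :
  all2 leq s s' -> all2 leq t t' -> all2 leq (s ++ t) (s' ++ t').
Proof. by elim: s s' => [|x s IHs] [|y s'] //= /andP[-> /IHs]. Qed.

Lemma all2_leq_separated v s t : size s = size t ->
  all (leq^~ v) s -> all (leq v) t -> all2 leq s t.
Proof.
elim: s t => [|x s IHs] [|y t] //= [st] /andP[xv sv] /andP[vy vt].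
by rewrite (leq_trans xv vy) IHs.
Qed.

Lemma all2_leq_take s t : sorted leq s -> sorted leq t -> size s <= size t ->
  (forall v, count (leq^~ v) s <= count (leq^~ v) t) ->
  all2 leq (take (size s) t) s.
Proof.
move=> ss tt st le_count; apply/all2_leqP; rewrite size_takel //.
split=> // i i_s.
rewrite nth_take // sorted_nth_leq ?(leq_trans i_s st) //.
by apply: leq_trans (le_count _); rewrite -sorted_nth_leq.
Qed.

Definition word_monomial (s : seq nat) : nat -> nat := fun t => count_mem t s.

Lemma monomial_word s : monomial (word_monomial s).
Proof.
exists (\max_(x <- s) x).+1 => i; rewrite ltnNge => /negP i_s.
apply/count_memPn/negP => i_in; apply: i_s.
exact: (leq_bigmax_seq (F := id)).
Qed.

Lemma eq_word_monomialP s t :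
  reflect (word_monomial s = word_monomial t) (perm_eq s t).
Proof.
apply: (iffP idP) => [/permP st|st]; first by apply/funext => x; apply: st.
by apply/allP => x _ /=; apply/eqP; apply: (congr1 (@^~ x) st).
Qed.

Lemma exists_sorted_word u :
  monomial u -> exists2 s, sorted leq s & u = word_monomial s.
Proof.
move=> [N uN]; pose s := flatten [seq nseq (u t) t | t <- iota 0 N].
exists (sort leq s); first exact: sort_sorted leq_total _.
have /eq_word_monomialP -> : perm_eq (sort leq s) s by rewrite perm_sort.
apply/funext => t; rewrite /word_monomial count_flatten -map_comp sumnE big_map.
have count_t i : (count_mem t \o (fun x => nseq (u x) x)) i = (i == t) * u i.
  by rewrite /= count_nseq.
rewrite (eq_bigr _ (fun i _ => count_t i)); have [tN|Nt] := ltnP t N.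
  rewrite (bigD1_seq t) ?mem_iota ?iota_uniq //= eqxx mul1n big1 ?addn0 // => i.
  by move=> /negPf ->.
by rewrite uN // big_seq big1 // => i; rewrite mem_iota; case: eqP => //; lia.
Qed.

Lemma mulx_word i s : mulx i (word_monomial s) = word_monomial (i :: s).
Proof. by apply/funext => t; rewrite /mulx /word_monomial /= eq_sym addnC. Qed.

Lemma mulx_sort_word i s :
  mulx i (word_monomial s) = word_monomial (sort leq (i :: s)).
Proof.
by rewrite mulx_word; apply/eq_word_monomialP; rewrite perm_sym perm_sort.
Qed.

Lemma subseq_mdivides_word s t :
  subseq s t -> mdivides (word_monomial s) (word_monomial t).
Proof. by move=> st x; apply: leq_count_subseq. Qed.

Lemma mdivides_word_take s t : sorted leq s -> sorted leq t ->
  mdivides (word_monomial s) (word_monomial t) -> all2 leq (take (size s) t) s.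
Proof.
move=> ss tt /count_subseqP[s' s't /[dup] /perm_size zs /permP cs].
apply: all2_leq_take => // [|v]; first by rewrite zs size_subseq.
by rewrite cs leq_count_subseq.
Qed.

Lemma all2_leq_sort_cons i j s :
  i <= j -> all2 leq (sort leq (i :: s)) (sort leq (j :: s)).
Proof.
move=> ij; pose si := sort leq (i :: s); pose sj := sort leq (j :: s).
have sz : size sj = size si by rewrite !size_sort.
rewrite -[X in all2 _ X]take_size -[size _]sz; apply: all2_leq_take.
- exact: sort_sorted leq_total _.
- exact: sort_sorted leq_total _.
- by rewrite sz.
- move=> v; rewrite !count_sort /= leq_add2r.
  by case: (leqP j v) => // jv; rewrite (leq_trans ij jv).
Qed.

Lemma strongly_stable_word_leq M s t : strongly_stable M -> all2 leq t s ->
  M (word_monomial s) -> M (word_monomial t).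
Proof.
move=> stable; suff cat_leq a : all2 leq t s -> M (word_monomial (a ++ s)) ->
  M (word_monomial (a ++ t)) by apply: (cat_leq [::]).
elim: s t a => [|x s IHs] [|y t] a //= /andP[yx ts] Mxs.
rewrite -cat_rcons; apply: IHs => //; rewrite cat_rcons.
have mulxE z : word_monomial (a ++ z :: s) = mulx z (word_monomial (a ++ s)).
  by rewrite mulx_word; apply/eq_word_monomialP; rewrite -cat1s perm_catCA.
rewrite mulxE; move: yx; rewrite leq_eqVlt => /orP[/eqP -> |yx].
  by rewrite -mulxE.
by apply: stable yx _; [apply: monomial_word | rewrite -mulxE].
Qed.

(** * Markers as words *)

Section Markers.
Variable m : nat.
Implicit Types (phi psi alpha : {ffun 'I_m -> nat}) (s t : seq nat).

Definition word_hom s : {ffun 'I_m -> nat} := [ffun i : 'I_m => nth 0 s i].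

Lemma size_codom_ord phi : size (codom phi) = m.
Proof. by rewrite size_codom card_ord. Qed.

Lemma nth_codom_ord phi (i : 'I_m) : nth 0 (codom phi) i = phi i.
Proof. by rewrite (nth_map i) ?size_enum_ord // nth_ord_enum. Qed.

Lemma codom_ordK phi : word_hom (codom phi) = phi.
Proof. by apply/ffunP => i; rewrite ffunE nth_codom_ord. Qed.

Lemma word_homK s : size s = m -> codom (word_hom s) = s.
Proof.
move=> zs; apply: (@eq_from_nth _ 0); rewrite size_codom_ord // => i im.
by rewrite (nth_codom_ord _ (Ordinal im)) ffunE.
Qed.

Lemma eq_take_codom phi psi r :
  (forall i : 'I_m, i < r -> phi i = psi i) <->
  take r (codom phi) = take r (codom psi).
Proof.
split=> [eq_r|eq_r i ir].
  apply: (@eq_from_nth _ 0); rewrite !size_take_min !size_codom_ord // => i.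
  rewrite leq_min => /andP[ir im].
  by rewrite !nth_take // !(nth_codom_ord _ (Ordinal im)) eq_r.
by rewrite -!nth_codom_ord -(nth_take 0 ir) eq_r nth_take.
Qed.

Lemma sorted_take_codom alpha r : r <= m ->
  (forall i j : 'I_m, i <= j -> j < r -> alpha i <= alpha j) <->
  sorted leq (take r (codom alpha)).
Proof.
move=> rm; have zr : size (take r (codom alpha)) = r.
  by rewrite size_takel ?size_codom_ord.
split=> [mono|sr i j ij jr].
  apply/(sortedP 0) => i; rewrite zr => ir.
  have im : i.+1 < m by apply: leq_trans rm.
  rewrite !nth_take ?(ltnW ir) // (nth_codom_ord _ (Ordinal im)).
  by rewrite (nth_codom_ord _ (Ordinal (ltnW im))); apply: mono.
have ir := leq_ltn_trans ij jr.
rewrite -!nth_codom_ord -(nth_take 0 ir) -(nth_take 0 jr).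
by apply: (sorted_leq_nth leq_trans leqnn); rewrite ?inE ?zr.
Qed.

Lemma isotone_codom phi : isotone phi <-> sorted leq (codom phi).
Proof.
have := sorted_take_codom phi (leqnn m).
rewrite take_oversize ?size_codom_ord // => <-.
by split=> iso i j ij; [move=> _|]; apply: iso.
Qed.

Lemma isotone_word_hom s : size s = m -> isotone (word_hom s) <-> sorted leq s.
Proof. by move=> zs; rewrite isotone_codom word_homK. Qed.

Lemma marker_monomialE r alpha : r <= m ->
  marker_monomial r alpha = word_monomial (take r (codom alpha)).
Proof.
move=> rm; apply/funext => t; rewrite /marker_monomial /word_monomial.
rewrite -sum1_card -sum1_count [RHS]big_mkcond (big_nth 0).
rewrite size_takel ?size_codom_ord // big_mkord.
rewrite (big_ord_widen m
  (fun i => if nth 0 (take r (codom alpha)) i == t then 1 else 0) rm).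
rewrite [LHS]big_mkcond [RHS]big_mkcond; apply: eq_bigr => i _.
by rewrite inE; case: ltnP => // ir; rewrite nth_take // nth_codom_ord.
Qed.

Definition homs_in (M : (nat -> nat) -> Prop) phi : Prop :=
  isotone phi /\ M (word_monomial (codom phi)).

Section Words.
Variable J : {ffun 'I_m -> nat} -> Prop.

Definition word_marker s : Prop :=
  [/\ sorted leq s, size s <= m &
      forall t, sorted leq t -> size t = m -> prefix s t -> J (word_hom t)].

Lemma is_markerP r alpha :
  is_marker J r alpha <-> r <= m /\ word_marker (take r (codom alpha)).
Proof.
have zr : r <= m -> size (take r (codom alpha)) = r.
  by move=> rm; rewrite size_takel ?size_codom_ord.
have agree phi : r <= m ->
    (forall i : 'I_m, i < r -> phi i = alpha i) <->
    prefix (take r (codom alpha)) (codom phi).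
  by move=> rm; rewrite eq_take_codom prefixE zr //; split=> [->|/eqP].
split=> [[rm [mono ext]]|[rm [sr _ ext]]]; split=> //.
  split=> [||t st zt]; [exact/sorted_take_codom | by rewrite zr |].
  rewrite -{1}(word_homK zt) => /(agree _ rm).
  by apply: ext; apply/isotone_word_hom.
split=> [|phi /isotone_codom sphi /(agree _ rm) pre].
  exact/sorted_take_codom.
by rewrite -[phi]codom_ordK; apply: ext; rewrite ?size_codom_ord.
Qed.

Lemma Lp2P u :
  Lp2 J u <->
  monomial u /\ exists2 s, word_marker s & mdivides (word_monomial s) u.
Proof.
split=> -[mon_u].
  move=> [r [alpha [/is_markerP[rm marker] alpha_u]]]; split=> //.
  by exists (take r (codom alpha)) => //; rewrite -marker_monomialE.
move=> [s marker s_u]; have [_ sm _] := marker; split=> //.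
exists (size s), (word_hom s); rewrite marker_monomialE //.
suff sE : take (size s) (codom (word_hom s)) = s by rewrite is_markerP sE.
apply: (@eq_from_nth _ 0) => [|i]; rewrite size_takel ?size_codom_ord // => i_s.
by rewrite nth_take // (nth_codom_ord _ (Ordinal (leq_trans i_s sm))) ffunE.
Qed.

End Words.

Section PosetIdeal.
Variable J : {ffun 'I_m -> nat} -> Prop.
Hypothesis J_ideal : hom_poset_ideal J.

Lemma word_hom_down s t :
  sorted leq s -> size s = m -> all2 leq s t ->
  J (word_hom t) -> J (word_hom s).
Proof.
move=> ss zs /all2_leqP[_ st] Jt; apply: (J_ideal.2 _ _ Jt).
  exact/isotone_word_hom.
by move=> i; rewrite !ffunE st ?zs.
Qed.

Lemma word_marker_down s t :
  word_marker J s -> sorted leq t -> all2 leq t s -> word_marker J t.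
Proof.
move=> [ss sm ext] tt ts; have [zts _] := all2_leqP _ _ ts.
split=> [||t' st' zt' /prefixP[w t'E]] //; first by rewrite zts.
pose s' := s ++ map (maxn (last 0 s)) w.
have zs' : size s' = m by rewrite size_cat size_map -zts -size_cat -t'E.
have ss' : sorted leq s'.
  rewrite sorted_cat_last ss /=; apply/andP; split; last first.
    by apply/allP => _ /mapP[x _ ->]; apply: leq_maxl.
  have sw : sorted leq w by move: st'; rewrite t'E sorted_cat_last => /and3P[].
  by apply: homo_sorted sw => x y xy; rewrite geq_max leq_maxl leq_max xy orbT.
apply: (@word_hom_down _ s') => //; last exact: ext (prefix_prefix _ _).
rewrite t'E; apply: all2_leq_cat => //.
by elim: (w) => //= x w' ->; rewrite leq_maxr.
Qed.

Lemma Lp2_sorted_word t : sorted leq t ->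
  Lp2 J (word_monomial t) <-> exists r, word_marker J (take r t).
Proof.
move=> st; split=> [/Lp2P[_ [s ms s_t]]|[r mr]].
  have [ss _ _] := ms; exists (size s); apply: (word_marker_down ms).
    exact: take_sorted.
  exact: mdivides_word_take.
apply/Lp2P; split; first exact: monomial_word.
by exists (take r t) => //; apply/subseq_mdivides_word/take_subseq.
Qed.

Lemma Lp2_strongly_stable : strongly_stable (Lp2 J).
Proof.
move=> _ i j /exists_sorted_word[s ss ->] ij; rewrite !mulx_sort_word.
have sorted_cons x := sort_sorted leq_total (x :: s).
move=> /(Lp2_sorted_word (sorted_cons j))[r mr].
apply/(Lp2_sorted_word (sorted_cons i)); exists r.
apply: (word_marker_down mr); first exact/take_sorted/sorted_cons.
have /all2_leqP[zij le_ij] := all2_leq_sort_cons s (ltnW ij).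
apply/all2_leqP; rewrite !size_take_min zij; split=> // l.
by rewrite leq_min => /andP[lr lj]; rewrite !nth_take // le_ij // zij.
Qed.

Lemma homs_in_Lp2 phi : J phi <-> homs_in (Lp2 J) phi.
Proof.
split=> [Jphi|[/isotone_codom iso /(Lp2_sorted_word iso)[r [_ _ ext]]]].
  have iso := J_ideal.1 _ Jphi; split=> //.
  have /isotone_codom sphi := iso; apply/(Lp2_sorted_word sphi).
  exists m; rewrite take_oversize ?size_codom_ord //.
  split; rewrite ?size_codom_ord // => t _ zt.
  rewrite prefixE size_codom_ord take_oversize ?zt // => /eqP ->.
  by rewrite codom_ordK.
by rewrite -[phi]codom_ordK; apply: ext; rewrite ?size_codom_ord ?prefix_take.
Qed.

Definition minimal_marker s : Prop :=
  word_marker J s /\ forall t, word_marker J t -> prefix t s -> t = s.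

Lemma exists_minimal_marker s : word_marker J s ->
  exists2 t, prefix t s & minimal_marker t.
Proof.
move=> ms; pose marks r := `[< word_marker J (take r s) >].
have ex_r : exists r, marks r.
  by exists (size s); apply/asboolP; rewrite take_size.
case: (ex_minnP ex_r) => r /asboolP mr r_min.
exists (take r s); first exact: prefix_take.
split=> // t mt tr; have ts := prefix_trans tr (prefix_take s r).
have tE : t = take (size t) s by apply/esym/eqP; rewrite -prefixE.
have rt : r <= size t by apply: r_min; apply/asboolP; rewrite -tE.
apply/eqP; move: tr; rewrite prefixE take_oversize // => [/eqP ->|] //.
by rewrite size_take_min geq_min rt.
Qed.

Lemma word_marker_extends s : word_marker J s ->
  exists t, [/\ sorted leq t, size t = m, prefix s t & J (word_hom t)].
Proof.
move=> [ss sm ext]; pose t := s ++ nseq (m - size s) (last 0 s).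
have st : sorted leq t by apply: sorted_cat_nseq.
have zt : size t = m by rewrite size_cat size_nseq subnKC.
have pt : prefix s t by apply: prefix_prefix.
by exists t; split=> //; apply: ext.
Qed.

(* If some t through s is not in J, then no word of J has a letter beyond
   [last 0 t] right after s. *)
Lemma next_letter_bounded s :
  sorted leq s -> size s <= m -> ~ word_marker J s ->
  exists b, forall v t, sorted leq t -> size t = m -> prefix (rcons s v) t ->
    J (word_hom t) -> v <= b.
Proof.
move=> ss sm nms.
have [t [st zt pt nJt]] : exists t,
    [/\ sorted leq t, size t = m, prefix s t & ~ J (word_hom t)].
  apply: contrapT => none; apply: nms; split=> // t st zt pt.
  by apply: contrapT => nJt; apply: none; exists t.
exists (last 0 t) => v t' st' zt' /prefixP[w' t'E] Jt'.
rewrite leqNgt; apply/negP => tv; apply: nJt; apply: word_hom_down Jt' => //.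
have [w tE] := prefixP pt.
have zw : size w = size (v :: w').
  by have := zt; rewrite -zt' tE t'E cat_rcons !size_cat => /addnI.
rewrite tE t'E cat_rcons; apply: all2_leq_cat; first by apply/all2_leqP.
apply: (all2_leq_separated zw (v := v)).
  apply/allP => x xw; apply: leq_trans (ltnW tv); apply: sorted_leq_last => //.
  by rewrite tE mem_cat xw orbT.
move: st'; rewrite t'E cat_rcons sorted_cat_last => /and3P[_ /= vw' _].
by rewrite leqnn (order_path_min leq_trans).
Qed.

Lemma minimal_markers_through_finite s : sorted leq s -> size s <= m ->
  exists L : seq (seq nat), forall t, minimal_marker t -> prefix s t -> t \in L.
Proof.
have [r] := ubnP (m - size s); elim: r s => // r IHr s sr ss sm.
have [ms|nms] := pselect (word_marker J s).
  by exists [:: s] => t [_ t_min] /(t_min _ ms) ->; rewrite mem_head.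
have [b hb] := next_letter_bounded ss sm nms.
have /fin_all_exists[L hL] (v : 'I_b.+1) : exists L : seq (seq nat),
    forall t, minimal_marker t -> prefix (rcons s v) t -> t \in L.
  have [[sv svm]|no] := pselect (sorted leq (rcons s v) /\ size s < m).
    by apply: IHr; rewrite ?size_rcons //; lia.
  exists [::] => t [[st tm _] _] svt; case: no; split.
    by apply: prefix_sorted st.
  by rewrite -(size_rcons s v); apply: leq_trans (size_prefix svt) tm.
exists (flatten [seq L v | v : 'I_b.+1]) => t mt /prefixP[[|v w] tE].
  by case: nms; have [] := mt; rewrite tE cats0.
have svt : prefix (rcons s v) t by rewrite tE -cat_rcons prefix_prefix.
have [t' [st' zt' tt' Jt']] := word_marker_extends mt.1.
have vb : v < b.+1 := hb v t' st' zt' (prefix_trans svt tt') Jt'.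
apply/flattenP; exists (L (Ordinal vb)); last exact: hL.
exact: codom_f.
Qed.

Lemma minimal_markers_finite :
  exists2 L, uniq L & forall s, s \in L <-> minimal_marker s.
Proof.
have [L hL] := @minimal_markers_through_finite [::] isT (leq0n m).
exists (undup [seq s <- L | `[< minimal_marker s >]]); first exact: undup_uniq.
move=> s; rewrite mem_undup mem_filter; split=> [/andP[/asboolP]|ms] //.
by rewrite asboolT ?hL ?prefix0s.
Qed.

Lemma Lp2_generates L : (forall s, s \in L <-> minimal_marker s) ->
  generates (Lp2 J) [seq word_monomial s | s <- L].
Proof.
move=> hL; split=> [_ /In_mem/mapP[s _ ->]|u]; first exact: monomial_word.
split=> [Lu|[mon_u [_ /In_mem/mapP[s /hL[ms _] ->] s_u]]]; last first.
  by apply/Lp2P; split=> //; exists s.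
have [mon_u _] := Lu; split=> //; have [t st uE] := exists_sorted_word mon_u.
move: Lu; rewrite uE => /(Lp2_sorted_word st)[r].
move=> /exists_minimal_marker[s sr ms].
exists (word_monomial s); first by apply/In_mem/map_f/hL.
by apply/subseq_mdivides_word/infixW/prefixW/(prefix_trans sr)/prefix_take.
Qed.

End PosetIdeal.

End Markers.

(** * Regularity of stable prefix codes *)

Section WordMultinomials.
Variable n : nat.
Implicit Types s t w : seq nat.

Definition word_mnm s : 'X_{1..n} := mon_of n (word_monomial s).

Lemma word_mnmE s i : word_mnm s i = count_mem (i : nat) s.
Proof. by rewrite mnmE. Qed.

Lemma word_mnm_cat s t : word_mnm (s ++ t) = (word_mnm s + word_mnm t)%MM.
Proof. by apply/mnmP => i; rewrite mnmDE !word_mnmE count_cat. Qed.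

Lemma word_mnm_cons (i : 'I_n) s :
  word_mnm ((i : nat) :: s) = (U_(i) + word_mnm s)%MM.
Proof. by apply/mnmP => j; rewrite mnmDE mnm1E !word_mnmE. Qed.

Lemma perm_word_mnm s t : perm_eq s t -> word_mnm s = word_mnm t.
Proof. by move=> /permP st; apply/mnmP => i; rewrite !word_mnmE st. Qed.

Lemma count_mem_out s i : all (ltn^~ n) s -> n <= i -> count_mem i s = 0.
Proof.
move=> /allP sn ni; apply/count_memPn/negP => /sn.
by rewrite /= ltnNge ni.
Qed.

Lemma word_mnm_inj s t : all (ltn^~ n) s -> all (ltn^~ n) t ->
  word_mnm s = word_mnm t -> perm_eq s t.
Proof.
move=> sn tn /mnmP st; apply/allP => i _ /=; apply/eqP.
have [i_n|ni] := ltnP i n; last by rewrite !count_mem_out.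
by have := st (Ordinal i_n); rewrite !word_mnmE.
Qed.

Lemma mdeg_word_mnm s : all (ltn^~ n) s -> mdeg (word_mnm s) = size s.
Proof.
elim: s => [_|x s IHs /= /andP[xn /IHs <-]].
  by rewrite mdegE big1 // => i _; rewrite word_mnmE.
by rewrite (word_mnm_cons (Ordinal xn)) mdegD mdeg1.
Qed.

Lemma exists_word_mnm (e : 'X_{1..n}) :
  exists s, [/\ sorted leq s, all (ltn^~ n) s & word_mnm s = e].
Proof.
pose u x := oapp (fun i : 'I_n => e i) 0 (insub x).
have [|s ss uE] := @exists_sorted_word u.
  by exists n => x nx; rewrite /u insubF // ltnNge nx.
have count_s x : count_mem x s = u x by rewrite uE.
exists s; split=> //; last first.
  by apply/mnmP => i; rewrite word_mnmE count_s /u valK.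
apply/allP => x; rewrite -has_pred1 has_count count_s /u.
by case: insubP => // i xn.
Qed.

Lemma vars_ge_word_mnm c s : all (ltn^~ n) s ->
  vars_ge c (word_mnm s) <-> all (leq c) s.
Proof.
move=> /allP sn; split=> [sc|/allP sc i ic].
  apply/allP => t ts; rewrite leqNgt; apply/negP => tc.
  have := sc (Ordinal (sn t ts)) tc; rewrite word_mnmE => /count_memPn.
  by rewrite ts.
by rewrite word_mnmE; apply/count_memPn/negP => /sc; rewrite leqNgt ic.
Qed.

Lemma mdivides_mon_of (u v : nat -> nat) : (forall i, n <= i -> u i = 0) ->
  mdivides u v <-> (mon_of n u <= mon_of n v)%MM.
Proof.
move=> u0; split=> [uv|/mnm_lepP uv i].
  by apply/mnm_lepP => i; rewrite !mnmE.
have [i_n|ni] := ltnP i n; last by rewrite u0.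
by have := uv (Ordinal i_n); rewrite !mnmE.
Qed.

End WordMultinomials.

Definition prefix_free (L : seq (seq nat)) : Prop :=
  {in L &, forall s t, prefix s t -> s = t}.

Definition stable_words (L : seq (seq nat)) : Prop :=
  forall s i, s \in L -> exists t,
    [/\ t \in L, size t <= size s & prefix t (sort leq (i :: s))].

Lemma prefix_free_cat (L : seq (seq nat)) s t w w' : prefix_free L ->
  s \in L -> t \in L -> sorted leq (s ++ w) -> sorted leq (t ++ w') ->
  perm_eq (s ++ w) (t ++ w') -> s = t.
Proof.
move=> free sL tL sw tw' /(sorted_eq leq_trans anti_leq sw tw') eq_cat.
have [st|/ltnW ts] := leqP (size s) (size t).
  apply: free => //.
  by rewrite prefixE -(takel_cat w' st) -eq_cat take_size_cat.
apply/esym/free => //.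
by rewrite prefixE -(takel_cat w ts) eq_cat take_size_cat.
Qed.

(* The letters of the remaining factor are at least [last 0 s], so the sum
   of the letters drops. *)
Lemma stable_words_decomp (L : seq (seq nat)) s i : stable_words L -> s \in L ->
  sorted leq s -> i < last 0 s -> exists t w,
    [/\ t \in L, sorted leq (t ++ w), perm_eq (t ++ w) (i :: s) &
        sumn t < sumn s].
Proof.
move=> stable sL ss i_s; have [t [tL ts /prefixP[w sortE]]] := stable s i sL.
have tw_perm : perm_eq (t ++ w) (i :: s) by rewrite -sortE perm_sort.
have tw_sorted : sorted leq (t ++ w).
  by rewrite -sortE; apply: sort_sorted leq_total _.
exists t, w; split=> //.
have := perm_sumn tw_perm; rewrite sumn_cat /= => sum_eq.
suff : last 0 s <= sumn w by lia.
have s_last : last 0 s \in t ++ w.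
  rewrite (perm_mem tw_perm) inE; apply/orP; right.
  by case: (s) i_s => // x s' _; apply: mem_last.
apply: leq_trans (sorted_leq_last tw_sorted s_last) _.
have w_n0 : w != [::].
  apply: contraTneq ts => w0; have := perm_size tw_perm.
  by rewrite w0 cats0 -ltnNge => ->.
case: (w) w_n0 => // x w' _; rewrite last_cat.
by have /perm_to_rem/perm_sumn -> := mem_last x w'; apply: leq_addr.
Qed.

Section StableWordsRow.
Variables (k : fieldType) (n reg : nat) (L : seq (seq nat)).
Hypothesis L_uniq : uniq L.
Hypothesis L_sorted : {in L, forall s, sorted leq s}.
Hypothesis L_letters : {in L, forall s, all (ltn^~ n) s}.
Hypothesis L_free : prefix_free L.
Hypothesis L_stable : stable_words L.

Local Notation gs := [seq word_monomial s | s <- L].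
Let gen (j : 'I_(size gs)) : seq nat := nth [::] L j.

Let gen_lt (j : 'I_(size gs)) : j < size L.
Proof. by rewrite -(size_map word_monomial). Qed.

Let gen_in j : gen j \in L.
Proof. exact/mem_nth/gen_lt. Qed.

Let gen_surj s : s \in L -> exists j, gen j = s.
Proof.
move=> sL; have s_lt : index s L < size gs by rewrite size_map index_mem.
by exists (Ordinal s_lt); rewrite /gen nth_index.
Qed.

Let gen_inj : injective gen.
Proof.
by move=> j j' /eqP; rewrite /gen nth_uniq ?gen_lt // => /eqP/val_inj.
Qed.

Let gen_mnm j := word_mnm n (gen j).

Lemma gen_row_words : gen_row k n gs = monomial_row k gen_mnm.
Proof. by apply/rowP => j; rewrite !mxE (nth_map [::]). Qed.

(* The two sorted products are the same word, so one of the generators is a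
   prefix of the other. *)
Lemma gen_mnm_decomp_uniq j j' e e' :
  vars_ge (last 0 (gen j)) e -> vars_ge (last 0 (gen j')) e' ->
  (gen_mnm j + e = gen_mnm j' + e')%MM -> j = j'.
Proof.
have [w [sw wn <-]] := exists_word_mnm e.
have [w' [sw' wn' <-]] := exists_word_mnm e'.
rewrite !vars_ge_word_mnm // => hw hw'; rewrite -!word_mnm_cat => eq_mnm.
have perm_cat : perm_eq (gen j ++ w) (gen j' ++ w').
  by apply: word_mnm_inj eq_mnm; rewrite all_cat ?wn ?wn' L_letters.
apply/gen_inj/(prefix_free_cat L_free (gen_in j) (gen_in j') _ _ perm_cat).
  by rewrite sorted_cat_last L_sorted ?sw.
by rewrite sorted_cat_last L_sorted ?sw'.
Qed.

Lemma gen_mnm_decomp j (i : 'I_n) : i < last 0 (gen j) -> exists j' e,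
  [/\ vars_ge (last 0 (gen j')) e, sumn (gen j') < sumn (gen j) &
      (U_(i) + gen_mnm j = gen_mnm j' + e)%MM].
Proof.
move=> i_last; have [t [w [/gen_surj[j' <-] sorted_cat perm_cat sum_lt]]] :=
  stable_words_decomp L_stable (gen_in j) (L_sorted (gen_in j)) i_last.
have wn : all (ltn^~ n) w.
  have : all (ltn^~ n) (gen j' ++ w).
    by rewrite (perm_all _ perm_cat) /= ltn_ord L_letters.
  by rewrite all_cat => /andP[].
exists j', (word_mnm n w); split=> //.
  apply/vars_ge_word_mnm => //.
  by move: sorted_cat; rewrite sorted_cat_last => /and3P[].
by rewrite -word_mnm_cons -word_mnm_cat; apply/esym/perm_word_mnm.
Qed.

Lemma stable_words_regular : {in L, forall s, size s <= reg} ->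
  has_regular_resolution (gen_row k n gs) reg.
Proof.
move=> L_size; rewrite gen_row_words.
apply: pommaret_monomial_row_regular => [|j].
  exact: pommaret_basis_monomial_row gen_mnm_decomp_uniq gen_mnm_decomp.
by rewrite mdeg_word_mnm ?L_letters ?L_size.
Qed.

End StableWordsRow.

Definition vars_lt (n : nat) (gs : seq (nat -> nat)) : Prop :=
  forall g, List.In g gs -> forall i, n <= i -> g i = 0.

Lemma regular_ideal_low_degree (k : fieldType) n reg M gs u :
  generates M gs -> vars_lt n gs ->
  has_regular_resolution (gen_row k n gs) reg -> M u ->
  exists s, [/\ sorted leq s, size s <= reg, M (word_monomial s) &
                mdivides (word_monomial s) u].
Proof.
move=> [_ gen_M] gs_n res /gen_M[_ [g g_gs gu]].
have /In_mem/(nthP (fun=> 0))[j j_gs gE] := g_gs.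
pose gen (j : 'I_(size gs)) := nth (fun=> 0) gs j.
have gen_row_E : gen_row k n gs = monomial_row k (fun j => mon_of n (gen j)).
  by apply/rowP => l; rewrite !mxE.
rewrite gen_row_E in res.
have [j' [e [j'e ej deg_e]]] :=
  regular_monomial_row_low_degree (Ordinal j_gs) res.
have gen_in : List.In (gen j') gs by apply/In_mem/mem_nth.
have [s [ss sn sE]] := exists_word_mnm e.
exists s; split=> //.
- by rewrite -(mdeg_word_mnm sn) sE.
- apply/gen_M; split; first exact: monomial_word.
  exists (gen j') => //; apply/(mdivides_mon_of _ (gs_n _ gen_in)).
  by rewrite -[X in (_ <= X)%MM]/(word_mnm n s) sE.
- move=> x; apply: leq_trans (gu x); move: x.
  apply/(@mdivides_mon_of n) => [i|]; first exact: count_mem_out.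
  by rewrite -gE -[mon_of _ _]/(word_mnm n s) sE.
Qed.

(** * The correspondence *)

Section MinimalMarkers.
Variables (m : nat) (J : {ffun 'I_m -> nat} -> Prop) (L : seq (seq nat)).
Hypothesis J_ideal : hom_poset_ideal J.
Hypothesis L_minimal : forall s, s \in L <-> minimal_marker J s.

Lemma prefix_free_minimal_markers : prefix_free L.
Proof. by move=> s t /L_minimal[ms _] /L_minimal[_ t_min]; apply: t_min. Qed.

Lemma stable_words_minimal_markers : stable_words L.
Proof.
move=> s i /L_minimal[ms _]; have [ss _ _] := ms; pose s' := sort leq (i :: s).
have ss' : sorted leq s' := sort_sorted leq_total _.
have s_s' : mdivides (word_monomial s) (word_monomial s').
  by rewrite -mulx_sort_word => x; apply: leq_addr.
have [|t ts' mt] := @exists_minimal_marker _ J (take (size s) s').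
  apply: (word_marker_down J_ideal ms); first exact: take_sorted.
  exact: mdivides_word_take.
exists t; split; first exact/L_minimal.
  by apply: leq_trans (size_prefix ts') _; rewrite size_take_min geq_minl.
exact: prefix_trans ts' (prefix_take _ _).
Qed.

Lemma Lp2_regular (k : fieldType) :
  uniq L -> regular_monomial_ideal k m (Lp2 J).
Proof.
move=> L_uniq; pose n := (\max_(x <- flatten L) x).+1.
have L_letters : {in L, forall s, all (ltn^~ n) s}.
  move=> s sL; apply/allP => x xs; rewrite /= ltnS.
  by apply: (leq_bigmax_seq (F := id)) => //; apply/flattenP; exists s.
exists [seq word_monomial s | s <- L], n; split; first exact: Lp2_generates.
split=> [_ /In_mem/mapP[s /L_letters sn ->] i|]; first exact: count_mem_out.
apply: stable_words_regular => // [s /L_minimal[[]] //|||s /L_minimal[[]] //].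
  exact: prefix_free_minimal_markers.
exact: stable_words_minimal_markers.
Qed.

End MinimalMarkers.

Lemma Lp2_fg_strongly_stable_regular (k : fieldType) m
    (J : {ffun 'I_m -> nat} -> Prop) :
  hom_poset_ideal J -> fg_strongly_stable_regular k m (Lp2 J).
Proof.
move=> J_ideal; have [L L_uniq L_minimal] := minimal_markers_finite J_ideal.
split; first by exists [seq word_monomial s | s <- L]; apply: Lp2_generates.
by split; [apply: Lp2_strongly_stable | apply: Lp2_regular L_uniq].
Qed.

Section GeneratedIdeals.
Variables (M : (nat -> nat) -> Prop) (gs : seq (nat -> nat)).
Hypothesis gen_M : generates M gs.

Lemma generates_mdivides u v : M u -> monomial v -> mdivides u v -> M v.
Proof.
move=> /gen_M.2[_ [g g_gs gu]] mon_v uv; apply/gen_M.2; split=> //.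
by exists g => // x; apply: leq_trans (gu x) (uv x).
Qed.

Lemma generates_cat_fresh n N r s :
  vars_lt n gs -> n <= N ->
  M (word_monomial (s ++ nseq r N)) -> M (word_monomial s).
Proof.
move=> gs_n nN /gen_M.2[_ [g g_gs g_sN]]; apply/gen_M.2.
split; first exact: monomial_word.
exists g => // x; have [xn|nx] := ltnP x n; last by rewrite (gs_n g).
have := g_sN x; rewrite /word_monomial count_cat count_nseq /=.
by case: eqP => [Nx|]; [move: nN; rewrite Nx leqNgt xn | rewrite addn0].
Qed.

Lemma word_marker_homs_in m n s :
  vars_lt n gs ->
  word_marker (homs_in (m := m) M) s <->
  [/\ sorted leq s, size s <= m & M (word_monomial s)].
Proof.
move=> gs_n; split=> [[ss sm ext]|[ss sm Ms]]; split=> //.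
  (* Fill up the marker with a variable occurring in no generator. *)
  pose N := maxn n (last 0 s); pose t := s ++ nseq (m - size s) N.
  have zt : size t = m by rewrite size_cat size_nseq subnKC.
  have st : sorted leq t by apply: sorted_cat_nseq (leq_maxr _ _).
  have [_] := ext _ st zt (prefix_prefix _ _); rewrite word_homK //.
  exact: generates_cat_fresh gs_n (leq_maxl _ _).
move=> t st zt ts; split; first exact/isotone_word_hom.
rewrite word_homK //; apply: generates_mdivides Ms (monomial_word t) _.
exact/subseq_mdivides_word/infixW/prefixW.
Qed.

End GeneratedIdeals.

Lemma hom_poset_ideal_homs_in m M :
  strongly_stable M -> hom_poset_ideal (homs_in (m := m) M).
Proof.
move=> stable; split=> [phi [] //|phi psi [iso Mphi] iso' le_phi]; split=> //.
apply: strongly_stable_word_leq Mphi => //; apply/all2_leqP.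
rewrite !size_codom_ord; split=> // i im.
by rewrite !(nth_codom_ord _ (Ordinal im)).
Qed.

Lemma Lp2_homs_in (k : fieldType) m M u :
  fg_strongly_stable_regular k m M -> M u <-> Lp2 (homs_in (m := m) M) u.
Proof.
move=> [_ [_ [gs [n [gen_M [gs_n res]]]]]].
have markerE s := word_marker_homs_in gen_M m s gs_n.
split=> [Mu|/Lp2P[mon_u [s /markerE[_ _ Ms] s_u]]]; last first.
  exact: (generates_mdivides gen_M Ms mon_u s_u).
have [s [ss sm Ms s_u]] := regular_ideal_low_degree gen_M gs_n res Mu.
apply/Lp2P; split; first by have [] := (gen_M.2 u).1 Mu.
by exists s => //; apply/markerE.
Qed.

Theorem theorem6p2 (k : fieldType) (m : nat) (hm : (1 <= m)%N) :
  (* L^{p2}([m], J) is a finitely generated strongly stable m-regular ideal *)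
  (forall J : {ffun 'I_m -> nat} -> Prop,
      hom_poset_ideal J -> fg_strongly_stable_regular k m (Lp2 J)) /\
  (* injectivity of J |-> L^{p2}([m], J) *)
  (forall J1 J2 : {ffun 'I_m -> nat} -> Prop,
      hom_poset_ideal J1 -> hom_poset_ideal J2 ->
      (forall u, Lp2 J1 u <-> Lp2 J2 u) -> forall phi, J1 phi <-> J2 phi) /\
  (* surjectivity onto finitely generated strongly stable m-regular ideals *)
  (forall M : (nat -> nat) -> Prop,
      fg_strongly_stable_regular k m M ->
      exists J : {ffun 'I_m -> nat} -> Prop,
        hom_poset_ideal J /\ forall u, M u <-> Lp2 J u).
Proof.
split; first by move=> J; apply: Lp2_fg_strongly_stable_regular.
split=> [J1 J2 J1_ideal J2_ideal eq_Lp2 phi|M M_reg].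
  by rewrite (homs_in_Lp2 J1_ideal) (homs_in_Lp2 J2_ideal) /homs_in eq_Lp2.
exists (homs_in M); split=> [|u]; last exact: Lp2_homs_in M_reg.
by apply: hom_poset_ideal_homs_in; case: M_reg => _ [].
Qed.
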